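(* Let $\gamma=[0,+\infty[\,\subset\mathbb{R}$. The observable category $\mathbf{Ob}$ is equivalent to the category $\mathrm{Mod}(\mathbf{k}_{\mathbb{R}_\gamma})$ of sheaves of $\mathbf{k}$-modules on $\mathbb{R}_\gamma$.
   Context: $\mathbf{k}$ is a field. $\mathbb{R}_\gamma$ is the set $\mathbb{R}$ with the $\gamma$-topology, for $\gamma=[0,+\infty[$: the open sets are the usual open subsets $U$ of $\mathbb{R}$ with $U+\gamma=U$. The observable category $\mathbf{Ob}$ (of Chazal, Crawley-Boevey and de Silva): its objects are the persistence modules over $\mathbb{R}$, i.e. functors $V$ from the poset $(\mathbb{R},\le)$ to $\mathbf{k}$-vector spaces, with structure maps $\rho^V_{ts}\colon V_s\to V_t$ for $s\le t$. A morphism $\phi\colon V\to W$ in $\mathbf{Ob}$ is a family of linear maps $\phi_{ts}\colon V_s\to W_t$, one for each pair $s<t$, such that $\rho^W_{ts}\,\phi_{sr}=\phi_{tr}=\phi_{ts}\,\rho^V_{sr}$ for all $r<s<t$. The composite of $\phi\colon U\to V$ and $\psi\colon V\to W$ is given by $(\psi\phi)_{ts}=\psi_{tu}\phi_{us}$ for any $u$ with $s<u<t$ (independent of $u$). *)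

(* Defs.v *)
From HB Require Import structures.
From mathcomp Require Import all_boot all_order all_algebra.
From mathcomp Require Import all_classical all_reals all_analysis.

Set Implicit Arguments.
Unset Strict Implicit.
Unset Printing Implicit Defensive.

Import Order.TTheory GRing.Theory Num.Theory.
Import numFieldNormedType.Exports.

Local Open Scope classical_set_scope.
Local Open Scope ring_scope.

Local Obligation Tactic := idtac.

Record category := Category {
  cobj :> Type;
  mor : cobj -> cobj -> Type;
  idmor : forall x, mor x x;
  compmor : forall x y z, mor y z -> mor x y -> mor x z;
  compmorA : forall x y z w (h : mor z w) (g : mor y z) (f : mor x y),
    compmor h (compmor g f) = compmor (compmor h g) f;
  compmor1l : forall x y (f : mor x y), compmor (idmor y) f = f;
  compmor1r : forall x y (f : mor x y), compmor f (idmor x) = f }.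

Arguments mor {c} x y.
Arguments idmor {c} x.
Arguments compmor {c x y z} g f.

Definition isomorphic (C : category) (x y : C) : Prop :=
  exists (f : mor x y) (g : mor y x),
    compmor g f = idmor x /\ compmor f g = idmor y.

Program Definition opposite (C : category) : category :=
  @Category C (fun x y => mor y x) (fun x => idmor x)
    (fun x y z g f => compmor f g) _ _ _.
Next Obligation. by move=> *; exact/esym/compmorA. Qed.
Next Obligation. by move=> *; exact: compmor1r. Qed.
Next Obligation. by move=> *; exact: compmor1l. Qed.

Record functor (C D : category) := Functor {
  fobj :> C -> D;
  fmor : forall x y : C, mor x y -> mor (fobj x) (fobj y);
  fmor1 : forall x, fmor (idmor x) = idmor (fobj x);
  fmorM : forall x y z (g : mor y z) (f : mor x y),
    fmor (compmor g f) = compmor (fmor g) (fmor f) }.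

Arguments fmor {C D} f {x y} u : rename.

Program Definition functor_id (C : category) : functor C C :=
  @Functor C C (fun x => x) (fun _ _ u => u) _ _.
Next Obligation. by []. Qed.
Next Obligation. by []. Qed.

Program Definition functor_comp (C D E : category)
    (G : functor D E) (F : functor C D) : functor C E :=
  @Functor C E (fun x => G (F x)) (fun _ _ u => fmor G (fmor F u)) _ _.
Next Obligation. by move=> C D E G F x; rewrite /= !fmor1. Qed.
Next Obligation. by move=> C D E G F x y z g f; rewrite /= !fmorM. Qed.

Record nat_trans (C D : category) (F G : functor C D) := NatTrans {
  nt_fun :> forall x : C, mor (F x) (G x);
  nt_natural : forall x y (u : mor x y),
    compmor (nt_fun y) (fmor F u) = compmor (fmor G u) (nt_fun x) }.

Lemma nat_trans_ext (C D : category) (F G : functor C D)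
    (a b : nat_trans F G) : (forall x, a x = b x) -> a = b.
Proof.
case: a b => a an [b bn] /= ab.
have {}ab : a = b by apply: functional_extensionality_dep.
by rewrite {}ab in an *; congr NatTrans; exact: Prop_irrelevance.
Qed.

Program Definition nat_trans_id (C D : category) (F : functor C D) :
    nat_trans F F :=
  @NatTrans C D F F (fun x => idmor (F x)) _.
Next Obligation. by move=> C D F x y u; rewrite compmor1l compmor1r. Qed.

Program Definition nat_trans_comp (C D : category) (F G H : functor C D)
    (b : nat_trans G H) (a : nat_trans F G) : nat_trans F H :=
  @NatTrans C D F H (fun x => compmor (b x) (a x)) _.
Next Obligation.
move=> C D F G H b a x y u.
by rewrite -compmorA nt_natural compmorA nt_natural compmorA.
Qed.

Program Definition functor_cat (C D : category) : category :=
  @Category (functor C D) (@nat_trans C D) (@nat_trans_id C D)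
    (@nat_trans_comp C D) _ _ _.
Next Obligation.
by move=> *; apply: nat_trans_ext => t; rewrite /= compmorA.
Qed.
Next Obligation.
by move=> *; apply: nat_trans_ext => t; rewrite /= compmor1l.
Qed.
Next Obligation.
by move=> *; apply: nat_trans_ext => t; rewrite /= compmor1r.
Qed.

Program Definition full_subcat (C : category) (P : C -> Prop) : category :=
  @Category {x : C | P x} (fun x y => mor (sval x) (sval y))
    (fun x => idmor (sval x)) (fun x y z g f => compmor g f) _ _ _.
Next Obligation. by move=> *; exact: compmorA. Qed.
Next Obligation. by move=> *; exact: compmor1l. Qed.
Next Obligation. by move=> *; exact: compmor1r. Qed.

Definition equivalent_categories (C D : category) : Prop :=
  exists (F : functor C D) (G : functor D C),
    isomorphic (functor_comp G F : functor_cat C C) (functor_id C) /\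
    isomorphic (functor_comp F G : functor_cat D D) (functor_id D).

Lemma linear_ext (k : fieldType) (V W : lmodType k) (f g : {linear V -> W}) :
  (forall x, f x = g x) -> f = g.
Proof.
move=> /funext; case: f g => f [[f1] [f2]] [g [[g1] [g2]]] /= fg.
rewrite {}fg in f1 f2 *.
by rewrite (Prop_irrelevance f1 g1) (Prop_irrelevance f2 g2).
Qed.

Program Definition Vect (k : fieldType) : category :=
  @Category (lmodType k) (fun V W => {linear V -> W})
    (fun V => idfun : {linear V -> V})
    (fun U V W g f => (g \o f) : {linear U -> W}) _ _ _.
Next Obligation. by move=> *; exact: linear_ext. Qed.
Next Obligation. by move=> *; exact: linear_ext. Qed.
Next Obligation. by move=> *; exact: linear_ext. Qed.

Section Observable.
Variables (R : realType) (k : fieldType).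

(* The poset (R, <=): there is one arrow s --> t exactly when s <= t. *)
Program Definition real_poset : category :=
  @Category R (fun s t => s <= t) (fun s => lexx s)
    (fun r s t st rs => le_trans rs st) _ _ _.
Next Obligation. by move=> *; exact: Prop_irrelevance. Qed.
Next Obligation. by move=> *; exact: Prop_irrelevance. Qed.
Next Obligation. by move=> *; exact: Prop_irrelevance. Qed.

Definition persistence_module := functor real_poset (Vect k).

Definition rho (V : persistence_module) (s t : R) (st : s <= t) :
    mor (V s) (V t) :=
  @fmor _ _ V s t st.

Record ob_hom (V W : persistence_module) := ObHom {
  ob_fun :> forall s t : R, s < t -> mor (V s) (W t);
  ob_rhol : forall (r s t : R) (rs : r < s) (st : s < t),
    compmor (rho W (ltW st)) (ob_fun rs) = ob_fun (lt_trans rs st);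
  ob_rhor : forall (r s t : R) (rs : r < s) (st : s < t),
    compmor (ob_fun st) (rho V (ltW rs)) = ob_fun (lt_trans rs st) }.

Lemma ob_hom_ext (V W : persistence_module) (f g : ob_hom V W) :
  (forall s t (st : s < t), f s t st = g s t st) -> f = g.
Proof.
case: f g => f f1 f2 [g g1 g2] /= fg.
have {}fg : f = g.
  do 3 (apply: functional_extensionality_dep => ?).
  exact: fg.
rewrite {}fg in f1 f2 *.
by congr ObHom; exact: Prop_irrelevance.
Qed.

Lemma ob_fun_irr (V W : persistence_module) (f : ob_hom V W) s t
  (p q : s < t) : f s t p = f s t q.
Proof. by rewrite (bool_irrelevance p q). Qed.

Lemma rhoM (V : persistence_module) r s t (rs : r <= s) (st : s <= t)
  (rt : r <= t) : rho V rt = compmor (rho V st) (rho V rs).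
Proof.
rewrite /rho -fmorM; congr (fmor V _); exact: bool_irrelevance.
Qed.

Lemma ob_comp_indep_lt (U V W : persistence_module)
    (g : ob_hom V W) (f : ob_hom U V) (s t u v : R)
    (su : s < u) (ut : u < t) (sv : s < v) (vt : v < t) (uv : u < v) :
  compmor (g u t ut) (f s u su) = compmor (g v t vt) (f s v sv).
Proof.
rewrite (ob_fun_irr f sv (lt_trans su uv)) -ob_rhol.
by rewrite compmorA ob_rhor; congr compmor; exact: ob_fun_irr.
Qed.

Lemma ob_comp_indep (U V W : persistence_module)
    (g : ob_hom V W) (f : ob_hom U V) (s t u v : R)
    (su : s < u) (ut : u < t) (sv : s < v) (vt : v < t) :
  compmor (g u t ut) (f s u su) = compmor (g v t vt) (f s v sv).
Proof.
case: (ltgtP u v) => [uv|vu|uv]; first exact: ob_comp_indep_lt.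
  by symmetry; exact: ob_comp_indep_lt.
case: _ / uv in sv vt *.
by congr compmor; exact: ob_fun_irr.
Qed.

Program Definition ob_id (V : persistence_module) : ob_hom V V :=
  @ObHom V V (fun s t st => rho V (ltW st)) _ _.
Next Obligation. by move=> V r s t rs st; exact/esym/rhoM. Qed.
Next Obligation. by move=> V r s t rs st; exact/esym/rhoM. Qed.

(* The intermediate point is chosen to be the midpoint of s and t; by
   [ob_comp_indep] any u with s < u < t gives the same composite. *)
Program Definition ob_comp (U V W : persistence_module)
    (g : ob_hom V W) (f : ob_hom U V) : ob_hom U W :=
  @ObHom U W (fun s t st =>
    compmor (g ((s + t) / 2) t (midf_lt st).2)
          (f s ((s + t) / 2) (midf_lt st).1)) _ _.
Next Obligation.
move=> U V W g f r s t rs st.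
rewrite compmorA ob_rhol; exact: ob_comp_indep.
Qed.
Next Obligation.
move=> U V W g f r s t rs st.
rewrite -compmorA ob_rhor; exact: ob_comp_indep.
Qed.

Lemma ob_compE (U V W : persistence_module) (g : ob_hom V W) (f : ob_hom U V)
    (s u t : R) (su : s < u) (ut : u < t) (st : s < t) :
  ob_comp g f s t st = compmor (g u t ut) (f s u su).
Proof. exact: ob_comp_indep. Qed.

Program Definition Ob : category :=
  @Category persistence_module ob_hom ob_id ob_comp _ _ _.
Next Obligation.
move=> x y z w h g f; apply: ob_hom_ext => s t st.
have [su ut] := midf_lt st.
have [uv vt] := midf_lt ut.
have hgfE : ob_comp h (ob_comp g f) s t st =
    compmor (h _ _ vt) (compmor (g _ _ uv) (f _ _ su)).
  by rewrite (ob_compE _ _ (lt_trans su uv) vt) (ob_compE _ _ su uv).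
have hg_fE : ob_comp (ob_comp h g) f s t st =
    compmor (compmor (h _ _ vt) (g _ _ uv)) (f _ _ su).
  by rewrite (ob_compE _ _ su ut) (ob_compE _ _ uv vt).
by rewrite [LHS]hgfE [RHS]hg_fE compmorA.
Qed.
Next Obligation.
move=> x y f; apply: ob_hom_ext => s t st.
exact: etrans (ob_rhol _ _ _) (ob_fun_irr _ _ _).
Qed.
Next Obligation.
move=> x y f; apply: ob_hom_ext => s t st.
exact: etrans (ob_rhor _ _ _) (ob_fun_irr _ _ _).
Qed.

End Observable.

Section Sheaves.
Variables (X : topologicalType) (k : fieldType).

Record opens := Opens { oset :> set X; oset_open : open oset }.

Program Definition opens_cat : category :=
  @Category opens (fun U V => U `<=` V) (fun U => @subset_refl _ U)
    (fun U V W VW UV => subset_trans UV VW) _ _ _.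
Next Obligation. by move=> *; exact: Prop_irrelevance. Qed.
Next Obligation. by move=> *; exact: Prop_irrelevance. Qed.
Next Obligation. by move=> *; exact: Prop_irrelevance. Qed.

Definition opensI (U V : opens) : opens :=
  Opens (openI (oset_open U) (oset_open V)).

Definition opens_bigcup (I : Type) (U : I -> opens) : opens :=
  Opens (bigcup_open (fun i (_ : [set: I] i) => oset_open (U i))).

Definition presheaf := functor (opposite opens_cat) (Vect k).

Definition sections (F : presheaf) (U : opens) : lmodType k := F U.

Definition restr (F : presheaf) (U V : opens) (VU : V `<=` U) :
    {linear sections F U -> sections F V} :=
  @fmor _ _ F U V VU.

(* The empty family is allowed, so a sheaf has a unique section over set0. *)
Definition is_sheaf (F : presheaf) : Prop :=
  forall (I : Type) (U : I -> opens) (s : forall i, sections F (U i)),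
    (forall i j,
      restr F (@subIsetl _ (U i) (U j) : opensI (U i) (U j) `<=` U i) (s i) =
      restr F (@subIsetr _ (U i) (U j) : opensI (U i) (U j) `<=` U j) (s j)) ->
    exists! t : sections F (opens_bigcup U),
      forall i, restr F (@bigcup_sup _ _ i setT U Logic.I :
                           U i `<=` opens_bigcup U) t = s i.

Definition sheaf_cat : category :=
  full_subcat (is_sheaf : functor_cat (opposite opens_cat) (Vect k) -> Prop).

End Sheaves.

Definition minkowski_sum (V : zmodType) (A B : set V) : set V :=
  [set x + y | x in A & y in B].

Section GammaTopology.
Variable R : realType.

Definition gamma : set R := `[0, +oo[.

Definition gamma_line : Type := R.
HB.instance Definition _ := Choice.on gamma_line.

Definition gamma_open (U : set R) : Prop :=
  open U /\ minkowski_sum U gamma = U.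

Lemma gamma_openP (U : set R) :
  gamma_open U <-> open U /\ forall x y, U x -> x <= y -> U y.
Proof.
split=> -[oU Ug]; split=> //.
  move=> x y Ux xy; rewrite -Ug; exists x => //; exists (y - x).
    by rewrite /gamma /= in_itv /= andbT subr_ge0.
  by rewrite addrC subrK.
apply/seteqP; split=> [_ [x Ux [g + <-]]|x Ux].
  by rewrite /gamma /= in_itv /= andbT => g0; apply: Ug Ux _; rewrite lerDl.
by exists x => //; exists 0; rewrite ?addr0// /gamma /= in_itv /= lexx.
Qed.

Let gamma_openT : gamma_open setT.
Proof. by apply/gamma_openP; split=> //; exact: openT. Qed.

Let gamma_openI : setI_closed gamma_open.
Proof.
move=> U V /gamma_openP[oU Uup] /gamma_openP[oV Vup].
apply/gamma_openP; split; first exact: openI.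
by move=> x y [Ux Vx] xy; split; [exact: Uup Ux xy|exact: Vup Vx xy].
Qed.

Let gamma_open_bigU (I : Type) (f : I -> set R) :
  (forall i, gamma_open (f i)) -> gamma_open (\bigcup_i f i).
Proof.
move=> fo; apply/gamma_openP; split.
  by apply: bigcup_open => i _; have [] := fo i.
move=> x y [i _ fix_] xy; exists i => //.
by have /gamma_openP[_ up] := fo i; exact: up fix_ xy.
Qed.

HB.instance Definition _ := @isOpenTopological.Build gamma_line gamma_open
  gamma_openT gamma_openI gamma_open_bigU.

Lemma open_gamma_line (U : set R) :
  open (U : set gamma_line) = gamma_open U.
Proof. by []. Qed.

End GammaTopology.

(* Main.v *)
Require Import Defs.
From HB Require Import structures.
From mathcomp Require Import all_boot all_order all_algebra.
From mathcomp Require Import all_classical all_reals all_analysis.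

(** Up to the empty set and the whole line, the opens of the gamma-line are the
    rays ]s, +oo[, one for each real s, and they shrink as s grows; so a sheaf S
    gives a persistence module s |-> S(]s, +oo[), which is [ray_module S].
    Conversely a persistence module V gives the presheaf whose sections over U
    are the compatible families of vectors of V_s, s in U, i.e. the limit of V
    restricted to U; opens being up-closed, families glue pointwise and this
    presheaf is a sheaf ([family_sheafP]).

    The construction V |-> [family_presheaf V] is functorial for the observable
    morphisms, although such a morphism f has no component V_t -> W_t: given a
    family x over U and t in U, openness provides s < t in U, and f_ts (x_s)
    does not depend on s ([hom_map_fam_indep]). In the other direction a map of
    sheaves commutes with restrictions, and its composites with the
    restrictions from ]s, +oo[ to ]t, +oo[ for s < t form an observable
    morphism ([ray_hom]).

    The two functors are quasi-inverse to each other.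
    - The module built from the sheaf of families of V has at s the limit of V
      over ]s, +oo[. It need not be V_s (the value at s itself is
      forgotten), but it is isomorphic to V in the observable category:
      evaluating a family over ]s, +oo[ at t > s, and spreading a vector of V_s
      over ]t, +oo[ by the transition maps, are mutually inverse observable
      morphisms ([eval_hom_is_iso]).
    - An open U is the union of the rays ]s, +oo[ with s in U, again because U
      is open and up-closed. The sheaf axiom for this covering says that a
      section over U is the same as a compatible family of sections over these
      rays ([ray_sections_bij]).
    Both comparison maps are natural, and a natural transformation whose
    components are isomorphisms is an isomorphism ([nat_trans_is_iso]). *)

Set Implicit Arguments.
Unset Strict Implicit.
Unset Printing Implicit Defensive.

Import Order.TTheory GRing.Theory Num.Theory.
Import numFieldNormedType.Exports.

Local Open Scope classical_set_scope.
Local Open Scope ring_scope.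

Local Obligation Tactic := idtac.

(** * Isomorphisms *)

Definition is_iso (C : category) (x y : C) (f : mor x y) : Prop :=
  exists g : mor y x, compmor g f = idmor x /\ compmor f g = idmor y.

Lemma is_iso_isomorphic (C : category) (x y : C) (f : mor x y) :
  is_iso f -> isomorphic x y.
Proof. by move=> [g fg]; exists f, g. Qed.

Lemma is_iso_isomorphic_sym (C : category) (x y : C) (f : mor x y) :
  is_iso f -> isomorphic y x.
Proof. by move=> [g [gf fg]]; exists g, f. Qed.

Lemma nat_trans_is_iso (C D : category) (F G : functor C D)
    (a : nat_trans F G) :
  (forall x, is_iso (a x)) -> is_iso (a : mor (F : functor_cat C D) G).
Proof.
move=> a_iso; pose b x := sval (cid (a_iso x)).
have ba x : compmor (b x) (a x) = idmor (F x) := (svalP (cid (a_iso x))).1.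
have ab x : compmor (a x) (b x) = idmor (G x) := (svalP (cid (a_iso x))).2.
have b_nat x y (u : mor x y) :
    compmor (b y) (fmor G u) = compmor (fmor F u) (b x).
  rewrite -[fmor G u]compmor1r -(ab x) (compmorA (fmor G u)) -nt_natural.
  by rewrite -(compmorA (a y)) compmorA ba compmor1l.
by exists (NatTrans b_nat); split; apply: nat_trans_ext => x /=.
Qed.

Lemma Vect_bij_is_iso (k : fieldType) (V W : lmodType k)
    (f : {linear V -> W}) :
  bijective f -> is_iso (f : mor (V : Vect k) W).
Proof.
move=> [g fK gK].
have g_lin : linear g.
  by move=> c x y; apply: (can_inj fK); rewrite linearP !gK.
pose gL : {linear W -> V} :=
  HB.pack g (GRing.isLinear.Build _ _ _ _ g g_lin).
by exists gL; split; apply: linear_ext => x /=; [rewrite fK|rewrite gK].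
Qed.

(** * The opens of the gamma-line *)

Section GammaOpens.
Variable R : realType.
Implicit Types U : opens (gamma_line R).

Lemma opens_up U (s t : R) : oset U s -> s <= t -> oset U t.
Proof. by have /gamma_openP[_ up] := oset_open U; exact: up. Qed.

(** Openness for the usual topology leaves room below each point, which the
    strict inequalities in observable morphisms require. *)
Lemma opens_lt U (t : R) : oset U t -> exists s : R, s < t /\ oset U s.
Proof.
have /gamma_openP[oU _] := oset_open U.
move=> Ut; have /nbhs_ballP[e /= e0 eU] := open_nbhs_nbhs (conj oU Ut).
exists (t - e / 2); split; first by rewrite ltrBlDr ltrDl divr_gt0.
apply: eU; rewrite /ball /= opprB addrC subrK gtr0_norm ?divr_gt0//.
by rewrite ltr_pdivrMr// ltr_pMr// ltr1n.
Qed.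

Lemma ray_open (s : R) : open (`]s, +oo[%classic : set (gamma_line R)).
Proof.
apply/gamma_openP; split; first exact: interval_open.
by move=> x y /=; rewrite !in_itv /= !andbT => /lt_le_trans; apply.
Qed.

Definition ray (s : R) : opens (gamma_line R) := Opens (ray_open s).

Lemma rayE (s t : R) : oset (ray s) t <-> s < t.
Proof. by rewrite /= in_itv /= andbT. Qed.

Lemma ray_sub (s t : R) : s <= t -> ray t `<=` ray s.
Proof. by move=> st x /rayE tx; apply/rayE; exact: le_lt_trans tx. Qed.

Lemma ray_sub_opens U (s : R) : oset U s -> ray s `<=` U.
Proof. by move=> Us x /rayE /ltW; exact: opens_up. Qed.

End GammaOpens.

(** * Compatible families over an open *)

Section Families.
Variables (R : realType) (k : fieldType).
Implicit Types V W : persistence_module R k.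
Implicit Types U : opens (gamma_line R).

(** [space], [transition] and [hom_map] display the objects and arrows of [Vect]
    as modules and linear maps, so that the generic linearity lemmas apply. *)
Definition space V (s : R) : lmodType k := V s.

Definition transition V (s t : R) (st : s <= t) :
  {linear space V s -> space V t} := rho V st.

Definition hom_map V W (f : ob_hom V W) (s t : R) (st : s < t) :
  {linear space V s -> space W t} := f s t st.

Lemma transition_id V s (ss : s <= s) v : transition V ss v = v.
Proof.
rewrite /transition /rho (_ : fmor V ss = idmor (V s))// -fmor1.
by congr (fmor V _); exact: bool_irrelevance.
Qed.

Lemma transition_comp V r s t (rs : r <= s) (st : s <= t) (rt : r <= t) v :
  transition V st (transition V rs v) = transition V rt v.
Proof. by rewrite /transition (rhoM V rs st rt). Qed.

(** Observable morphisms absorb transition maps along weak inequalities as well,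
    the case of equality being trivial; likewise in [hom_transition]. *)
Lemma transition_hom V W (f : ob_hom V W) r s t (rs : r < s) (st : s <= t)
    (rt : r < t) v :
  transition W st (hom_map f rs v) = hom_map f rt v.
Proof.
have /predU1P[ste|st'] : (s == t) || (s < t) by rewrite -le_eqVlt.
  case: _ / ste in st rt *; rewrite transition_id.
  by rewrite (bool_irrelevance rs rt).
rewrite (bool_irrelevance rt (lt_trans rs st')).
rewrite (bool_irrelevance st (ltW st')).
by rewrite /hom_map -(ob_rhol f rs st').
Qed.

Lemma hom_transition V W (f : ob_hom V W) r s t (rs : r <= s) (st : s < t)
    (rt : r < t) v :
  hom_map f st (transition V rs v) = hom_map f rt v.
Proof.
have /predU1P[rse|rs'] : (r == s) || (r < s) by rewrite -le_eqVlt.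
  case: _ / rse in rs st *; rewrite transition_id.
  by rewrite (bool_irrelevance st rt).
rewrite (bool_irrelevance rt (lt_trans rs' st)).
rewrite (bool_irrelevance rs (ltW rs')).
by rewrite /hom_map -(ob_rhor f rs' st).
Qed.

Lemma hom_comp V W Z (g : ob_hom W Z) (f : ob_hom V W) r s t
    (rs : r < s) (st : s < t) (rt : r < t) v :
  hom_map (ob_comp g f) rt v = hom_map g st (hom_map f rs v).
Proof. by rewrite /hom_map (ob_compE _ _ rs st). Qed.

(** The limit of V over the up-closed set U. It is a record of its own, on which
    the module structure is then put componentwise. *)
Record family V U := Family {
  fam : forall s : R, oset U s -> space V s;
  famP : forall (s t : R) (st : s <= t) (Us : oset U s) (Ut : oset U t),
    transition V st (fam Us) = fam Ut }.

Lemma family_ext V U (x y : family V U) :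
  (forall s (Us : oset U s), fam x Us = fam y Us) -> x = y.
Proof.
case: x y => x xP [y yP] /= xy.
have {}xy : x = y.
  by do 2 (apply: functional_extensionality_dep => ?); exact: xy.
by rewrite {}xy in xP *; congr Family; exact: Prop_irrelevance.
Qed.

HB.instance Definition _ V U := gen_eqMixin (family V U).
HB.instance Definition _ V U := gen_choiceMixin (family V U).

Program Definition family0 V U : family V U := @Family V U (fun _ _ => 0) _.
Next Obligation. by move=> *; rewrite linear0. Qed.

Program Definition familyN V U (x : family V U) : family V U :=
  @Family V U (fun s Us => - fam x Us) _.
Next Obligation. by move=> V U x s t st Us Ut; rewrite linearN (famP x st). Qed.

Program Definition familyD V U (x y : family V U) : family V U :=
  @Family V U (fun s Us => fam x Us + fam y Us) _.
Next Obligation.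
move=> V U x y s t st Us Ut.
by rewrite linearD (famP x st Us Ut) (famP y st Us Ut).
Qed.

Program Definition familyZ V U (c : k) (x : family V U) : family V U :=
  @Family V U (fun s Us => c *: fam x Us) _.
Next Obligation.
by move=> V U c x s t st Us Ut; rewrite linearZ (famP x st Us Ut).
Qed.

Section FamilyLmodule.
Variables (V : persistence_module R k) (U : opens (gamma_line R)).

Let faddA : associative (@familyD V U).
Proof. by move=> x y z; apply: family_ext => s Us /=; rewrite addrA. Qed.
Let faddC : commutative (@familyD V U).
Proof. by move=> x y; apply: family_ext => s Us /=; rewrite addrC. Qed.
Let fadd0 : left_id (family0 V U) (@familyD V U).
Proof. by move=> x; apply: family_ext => s Us /=; rewrite add0r. Qed.
Let faddN : left_inverse (family0 V U) (@familyN V U) (@familyD V U).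
Proof. by move=> x; apply: family_ext => s Us /=; rewrite addNr. Qed.

HB.instance Definition _ :=
  GRing.isZmodule.Build (family V U) faddA faddC fadd0 faddN.

Let fscaleA a b (x : family V U) :
  familyZ a (familyZ b x) = familyZ (a * b) x.
Proof. by apply: family_ext => s Us /=; rewrite scalerA. Qed.
Let fscale1 : left_id 1 (@familyZ V U).
Proof. by move=> x; apply: family_ext => s Us /=; rewrite scale1r. Qed.
Let fscaleDr : right_distributive (@familyZ V U) +%R.
Proof. by move=> a x y; apply: family_ext => s Us /=; rewrite scalerDr. Qed.
Let fscaleDl x : {morph (@familyZ V U)^~ x : a b / a + b}.
Proof. by move=> a b; apply: family_ext => s Us /=; rewrite scalerDl. Qed.

HB.instance Definition _ := GRing.Zmodule_isLmodule.Build k (family V U)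
  fscaleA fscale1 fscaleDr fscaleDl.

End FamilyLmodule.

Lemma fam_lin V U c (x y : family V U) s (Us : oset U s) :
  fam (c *: x + y) Us = c *: fam x Us + fam y Us.
Proof. by []. Qed.

Section Restriction.
Variables (V : persistence_module R k) (U U' : opens (gamma_line R)).
Hypothesis sub : U' `<=` U.

Program Definition restrict (x : family V U) : family V U' :=
  @Family V U' (fun s Us => fam x (sub Us)) _.
Next Obligation. by move=> x s t st Us Ut; exact: famP. Qed.

Let restrict_lin : linear restrict.
Proof. by move=> c x y; exact: family_ext. Qed.

HB.instance Definition _ :=
  GRing.isLinear.Build k (family V U) (family V U') _ restrict restrict_lin.

End Restriction.

(** * From persistence modules to sheaves *)

Program Definition family_presheaf V : presheaf (gamma_line R) k :=
  @Functor (opposite (opens_cat (gamma_line R))) (Vect k)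
    (fun U => family V U : lmodType k)
    (fun U U' (sub : U' `<=` U) => restrict sub : {linear _ -> _}) _ _.
Next Obligation.
move=> V U; apply: linear_ext => x; apply: family_ext => s Us /=.
by congr fam; exact: Prop_irrelevance.
Qed.
Next Obligation.
move=> V U U' U'' s1 s2; apply: linear_ext => x; apply: family_ext => s Us /=.
by congr fam; exact: Prop_irrelevance.
Qed.

(** A point s of the union of the U_i lies in some U_i, whose family gives the
    value at s; agreement on intersections makes the choice of i irrelevant.
    The glued family is compatible since U_i contains every t >= s. *)
Lemma family_sheafP V : is_sheaf (family_presheaf V).
Proof.
move=> I U x agree.
have xE i j s (Ui : oset (U i) s) (Uj : oset (U j) s) :
    fam (x i : family V (U i)) Ui = fam (x j : family V (U j)) Uj.
  have := congr1 (fun y : family V (opensI (U i) (U j)) =>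
    fam y (conj Ui Uj : oset (opensI (U i) (U j)) s)) (agree i j).
  rewrite /= => xij; transitivity (fam (x i : family V (U i))
    (subIsetl (conj Ui Uj : (oset (U i) `&` oset (U j)) s))).
    by congr fam; exact: Prop_irrelevance.
  by rewrite [LHS]xij; congr fam; exact: Prop_irrelevance.
have cov s (Us : oset (opens_bigcup U) s) : exists i, oset (U i) s.
  by case: Us => i _ Uis; exists i.
pose y s (Us : oset (opens_bigcup U) s) : space V s :=
  fam (x (sval (cid (cov s Us))) : family V _) (svalP (cid (cov s Us))).
have yE s Us i (Ui : oset (U i) s) : y s Us = fam (x i : family V (U i)) Ui.
  exact: xE.
have yP s t (st : s <= t) Us Ut : transition V st (y s Us) = y t Ut.
  have [i Ui] := cov s Us.
  by rewrite (yE _ _ _ Ui) (yE _ _ _ (opens_up Ui st)); exact: famP.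
exists (Family yP : sections (family_presheaf V) _); split.
  by move=> i; apply: family_ext => s Us; exact: yE.
move=> z zP; apply: family_ext => s Us; have [i Ui] := cov s Us.
rewrite [LHS](yE _ _ _ Ui) -(zP i) /=.
by congr fam; exact: Prop_irrelevance.
Qed.

Definition family_sheaf V : sheaf_cat (gamma_line R) k :=
  exist _ (family_presheaf V) (@family_sheafP V).

Section HomFamily.
Variables (V W : persistence_module R k) (f : ob_hom V W).
Variable U : opens (gamma_line R).

(** If s <= s' then x_s' is the image of x_s, and f absorbs the transition map
    from s to s'. *)
Lemma hom_map_fam_indep (x : family V U) (t s s' : R) (st : s < t)
    (st' : s' < t) (Us : oset U s) (Us' : oset U s') :
  hom_map f st (fam x Us) = hom_map f st' (fam x Us').
Proof.
wlog ss' : s s' st st' Us Us' / s <= s'.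
  by move=> wl; have [/wl|/ltW/wl] := leP s s'; [apply|move=> ->].
by rewrite -(famP x ss' Us Us') (hom_transition f ss' st' st).
Qed.

(** The point below t is an arbitrary choice; by [hom_valueE] any other gives
    the same value. *)
Definition hom_value (x : family V U) (t : R) (Ut : oset U t) : space W t :=
  let p := cid (opens_lt Ut) in
  hom_map f (svalP p).1 (fam x (svalP p).2).

Lemma hom_valueE (x : family V U) (s t : R) (st : s < t) (Us : oset U s)
    (Ut : oset U t) :
  hom_value x Ut = hom_map f st (fam x Us).
Proof. exact: hom_map_fam_indep. Qed.

Program Definition hom_family (x : family V U) : family W U :=
  @Family W U (hom_value x) _.
Next Obligation.
move=> x s t st Us Ut; have [r [rs Ur]] := opens_lt Us.
rewrite (hom_valueE x rs Ur) (hom_valueE x (lt_le_trans rs st) Ur).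
exact: transition_hom.
Qed.

Let hom_family_lin : linear hom_family.
Proof.
move=> c x y; apply: family_ext => t Ut; have [s [st Us]] := opens_lt Ut.
by rewrite fam_lin /= !(hom_valueE _ st Us) fam_lin linearP.
Qed.

HB.instance Definition _ :=
  GRing.isLinear.Build k (family V U) (family W U) _ hom_family hom_family_lin.

End HomFamily.

Program Definition hom_family_nat V W (f : ob_hom V W) :
    nat_trans (family_presheaf V) (family_presheaf W) :=
  @NatTrans _ _ (family_presheaf V) (family_presheaf W)
    (fun U => @hom_family V W f U : {linear _ -> _}) _.
Next Obligation.
move=> V W f U U' sub; apply: linear_ext => x; apply: family_ext => t Ut /=.
have [s [st Us]] := opens_lt Ut.
by rewrite (hom_valueE f _ st Us) (hom_valueE f _ st (sub _ Us)).
Qed.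

Program Definition family_functor :
    functor (Ob R k) (sheaf_cat (gamma_line R) k) :=
  @Functor (Ob R k) (sheaf_cat (gamma_line R) k) family_sheaf
    hom_family_nat _ _.
Next Obligation.
move=> V; apply: nat_trans_ext => U; apply: linear_ext => x.
apply: family_ext => t Ut /=; have [s [st Us]] := opens_lt Ut.
by rewrite (hom_valueE _ _ st Us) -(famP x (ltW st) Us Ut).
Qed.
Next Obligation.
move=> V W Z g f; apply: nat_trans_ext => U; apply: linear_ext => x.
apply: family_ext => t Ut /=; have [u [ut Uu]] := opens_lt Ut.
have [s [su Us]] := opens_lt Uu.
rewrite (hom_valueE _ _ (lt_trans su ut) Us) (hom_valueE g _ ut Uu) /=.
rewrite (hom_valueE f _ su Us); exact: hom_comp.
Qed.

End Families.

(** * From sheaves to persistence modules *)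

Section Rays.
Variables (R : realType) (k : fieldType).
Implicit Types S T : presheaf (gamma_line R) k.
Implicit Types U : opens (gamma_line R).

Lemma restr_id S U (UU : U `<=` U) x : restr S UU x = x.
Proof.
rewrite (Prop_irrelevance UU (@subset_refl _ U)).
exact: (congr1 (fun h : {linear sections S U -> sections S U} => h x)
  (fmor1 S U)).
Qed.

Lemma restr_comp S U U' U'' (s1 : U' `<=` U) (s2 : U'' `<=` U')
    (s3 : U'' `<=` U) x :
  restr S s2 (restr S s1 x) = restr S s3 x.
Proof.
rewrite (Prop_irrelevance s3 (subset_trans s2 s1)).
exact: (congr1 (fun h : {linear sections S U -> sections S U''} => h x)
  (esym (@fmorM _ _ S U U' U'' s2 s1))).
Qed.

Lemma nat_restr S T (a : nat_trans S T) U U' (sub : U' `<=` U) x :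
  (a U' : {linear sections S U' -> sections T U'}) (restr S sub x) =
  restr T sub ((a U : {linear sections S U -> sections T U}) x).
Proof.
exact: (congr1 (fun h : {linear sections S U -> sections T U'} => h x)
  (nt_natural a sub)).
Qed.

Program Definition ray_module S : persistence_module R k :=
  @Functor (real_poset R) (Vect k) (fun s => sections S (ray s))
    (fun s t st => restr S (ray_sub st)) _ _.
Next Obligation. by move=> S s; apply: linear_ext => x; rewrite restr_id. Qed.
Next Obligation.
move=> S r s t st rs; apply: linear_ext => x.
by rewrite /= (restr_comp _ _ (ray_sub (le_trans rs st))).
Qed.

Program Definition ray_hom S T (a : nat_trans S T) :
    ob_hom (ray_module S) (ray_module T) :=
  @ObHom R k (ray_module S) (ray_module T)
    (fun s t st => compmor (a (ray t)) (restr S (ray_sub (ltW st)))) _ _.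
Next Obligation.
move=> S T a r s t rs st; apply: linear_ext => x /=.
by rewrite -nat_restr (restr_comp _ _ (ray_sub (ltW (lt_trans rs st)))).
Qed.
Next Obligation.
move=> S T a r s t rs st; apply: linear_ext => x /=.
by rewrite (restr_comp _ _ (ray_sub (ltW (lt_trans rs st)))).
Qed.

Program Definition ray_functor :
    functor (sheaf_cat (gamma_line R) k) (Ob R k) :=
  @Functor (sheaf_cat (gamma_line R) k) (Ob R k)
    (fun A => ray_module (sval A)) (fun _ _ a => ray_hom a) _ _.
Next Obligation.
by move=> S; apply: ob_hom_ext => s t st; apply: linear_ext.
Qed.
Next Obligation.
move=> S T Z b a; apply: ob_hom_ext => s t st; apply: linear_ext => x /=.
have [su ut] := midf_lt st.
by rewrite -nat_restr (restr_comp _ _ (ray_sub (ltW st))).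
Qed.

(** * The two comparison transformations *)

Section Evaluation.
Variable V : persistence_module R k.

Section Maps.
Variables (s t : R) (st : s < t).

Definition eval_family (x : family V (ray s)) : space V t :=
  fam x ((rayE s t).2 st).

Let eval_family_lin : linear eval_family.
Proof. by []. Qed.

HB.instance Definition _ := GRing.isLinear.Build k
  (family V (ray s)) (space V t) _ eval_family eval_family_lin.

(** The target lives over the ray of t and not of s, as the component of an
    observable morphism at s < t must. *)
Program Definition orbit_family (v : space V s) : family V (ray t) :=
  @Family R k V (ray t)
    (fun r tr => transition V (ltW (lt_trans st ((rayE t r).1 tr))) v) _.
Next Obligation. by move=> v r q rq tr tq; exact: transition_comp. Qed.

Let orbit_family_lin : linear orbit_family.
Proof. by move=> c x y; apply: family_ext => r tr /=; rewrite linearP. Qed.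

HB.instance Definition _ := GRing.isLinear.Build k
  (space V s) (family V (ray t)) _ orbit_family orbit_family_lin.

End Maps.

Program Definition eval_hom :
    ob_hom (ray_module (family_presheaf V)) V :=
  @ObHom R k (ray_module (family_presheaf V)) V
    (fun s t st => eval_family st : {linear _ -> _}) _ _.
Next Obligation.
move=> r s t rs st; apply: linear_ext => x; exact: famP.
Qed.
Next Obligation.
move=> r s t rs st; apply: linear_ext => x.
by rewrite /= /eval_family /=; congr fam; exact: Prop_irrelevance.
Qed.

Program Definition orbit_hom :
    ob_hom V (ray_module (family_presheaf V)) :=
  @ObHom R k V (ray_module (family_presheaf V))
    (fun s t st => orbit_family st : {linear _ -> _}) _ _.
Next Obligation.
move=> r s t rs st; apply: linear_ext => x; apply: family_ext => q tq /=.
by congr (transition V _ x); exact: bool_irrelevance.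
Qed.
Next Obligation.
move=> r s t rs st; apply: linear_ext => x; apply: family_ext => q tq /=.
exact: transition_comp.
Qed.

(** For s < t, both composites are the transition map from s to t, i.e. the
    identity at s < t: for families because x_r is the image of x_u whenever
    s < u <= r. *)
Lemma eval_hom_is_iso :
  is_iso (eval_hom : mor (ray_module (family_presheaf V) : Ob R k) V).
Proof.
exists orbit_hom; split; apply: ob_hom_ext => s t st; apply: linear_ext => x.
  apply: family_ext => r tr /=; exact: famP.
rewrite /= /eval_family /=.
by congr (transition V _ x); exact: bool_irrelevance.
Qed.

End Evaluation.

(** Naturality at s < t compares two values f_tu (x_u) of the same family x for
    different points u between s and t. *)
Program Definition eval_nat :
    nat_trans (functor_comp ray_functor (family_functor R k))
              (functor_id (Ob R k)) :=
  @NatTrans (Ob R k) (Ob R k) (functor_comp ray_functor (family_functor R k))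
    (functor_id (Ob R k)) eval_hom _.
Next Obligation.
move=> V W f; apply: ob_hom_ext => s t st; apply: linear_ext => x.
have [su ut] := midf_lt st.
have [uv vt] := midf_lt ut.
rewrite /= /eval_family /= (hom_valueE f _ vt ((rayE _ _).2 uv)).
exact: (@hom_map_fam_indep _ _ V W f (ray s) x).
Qed.

Section RaySections.
Variables (S : presheaf (gamma_line R) k) (U : opens (gamma_line R)).

Program Definition ray_sections (x : sections S U) : family (ray_module S) U :=
  @Family R k (ray_module S) U (fun s Us => restr S (ray_sub_opens Us) x) _.
Next Obligation. by move=> x s t st Us Ut; exact: restr_comp. Qed.

Let ray_sections_lin : linear ray_sections.
Proof. by move=> c x y; apply: family_ext => r tr /=; rewrite linearP. Qed.

HB.instance Definition _ := GRing.isLinear.Build k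
  (sections S U) (family (ray_module S) U) _ ray_sections ray_sections_lin.

(** This is the sheaf axiom for the covering of U by the rays ]s, +oo[, s in U.
    The union of that covering equals U as a set but is a different term, so
    sections are moved between the two by restriction along both inclusions. *)
Lemma ray_sections_bij : is_sheaf S -> bijective ray_sections.
Proof.
move=> sheafS.
pose cover (i : {s : R | oset U s}) := ray (sval i).
have coverU : opens_bigcup cover `<=` U.
  by move=> t [[s Us] _]; exact: ray_sub_opens.
have Ucover : U `<=` opens_bigcup cover.
  move=> t Ut; have [s [st Us]] := opens_lt Ut.
  by exists (exist _ s Us) => //; exact/rayE.
pose loc (y : family (ray_module S) U) (i : {s : R | oset U s}) :
  sections S (cover i) := fam y (svalP i).
pose subl i j : opensI (cover i) (cover j) `<=` cover i := @subIsetl _ _ _.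
pose subr i j : opensI (cover i) (cover j) `<=` cover j := @subIsetr _ _ _.
have agree y i j :
    restr S (subl i j) (loc y i) = restr S (subr i j) (loc y j).
  (* Of two rays one contains the other, so compatibility of y suffices. *)
  wlog ij : i j / sval i <= sval j.
    move=> wl; have [/wl//|/ltW/wl ji] := leP (sval i) (sval j).
    have sub : opensI (cover i) (cover j) `<=` opensI (cover j) (cover i).
      by move=> z [].
    have := congr1 (restr S sub) ji.
    rewrite (restr_comp _ _ (subr i j)).
    by rewrite (restr_comp _ _ (subl i j)).
  have <- : restr S (ray_sub ij) (loc y i) = loc y j.
    exact: (famP y ij (svalP i) (svalP j)).
  by rewrite (restr_comp _ _ (subl i j)).
pose glue y := sval (cid (sheafS _ cover (loc y) (agree y))).
have glueP y := svalP (cid (sheafS _ cover (loc y) (agree y))).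
exists (fun y => restr S Ucover (glue y)) => [x|y].
  have [_ /(_ (restr S coverU x))] := glueP (ray_sections x).
  rewrite -/(glue _) => ->.
    by rewrite (restr_comp _ _ (@subset_refl _ U)) restr_id.
  by move=> i; rewrite (restr_comp _ _ (ray_sub_opens (svalP i))).
apply: family_ext => s Us; transitivity (loc y (exist _ s Us)).
  by have [yE _] := glueP y; rewrite -yE; exact: restr_comp.
by rewrite /loc; congr fam; exact: Prop_irrelevance.
Qed.

End RaySections.

Program Definition ray_sections_presheaf_nat S :
    nat_trans S (family_presheaf (ray_module S)) :=
  @NatTrans _ _ S (family_presheaf (ray_module S))
    (fun U => @ray_sections S U : {linear _ -> _}) _.
Next Obligation.
move=> S U U' sub; apply: linear_ext => x; apply: family_ext => s Us.
exact: restr_comp.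
Qed.

Program Definition ray_sections_nat :
    nat_trans (functor_id (sheaf_cat (gamma_line R) k))
              (functor_comp (family_functor R k) ray_functor) :=
  @NatTrans (sheaf_cat (gamma_line R) k) (sheaf_cat (gamma_line R) k)
    (functor_id (sheaf_cat (gamma_line R) k))
    (functor_comp (family_functor R k) ray_functor)
    (fun A => ray_sections_presheaf_nat (sval A)) _.
Next Obligation.
move=> S T a; apply: nat_trans_ext => U; apply: linear_ext => x.
apply: family_ext => t Ut /=; have [s [st Us]] := opens_lt Ut.
rewrite (hom_valueE _ _ st Us) /= (restr_comp _ _ (ray_sub_opens Ut)).
by rewrite -nat_restr.
Qed.

Lemma ray_sections_nat_is_iso (S : sheaf_cat (gamma_line R) k) :
  is_iso (ray_sections_nat S).
Proof.
have [b ab] : is_iso (ray_sections_presheaf_nat (sval S) :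
    mor (sval S : functor_cat _ _) _).
  apply: nat_trans_is_iso => U; apply: Vect_bij_is_iso.
  exact: ray_sections_bij (svalP S).
by exists b.
Qed.

End Rays.

Theorem corollary3p9 (R : realType) (k : fieldType) :
  equivalent_categories (Ob R k) (sheaf_cat (gamma_line R) k).
Proof.
exists (family_functor R k), (ray_functor R k); split.
  apply: (@is_iso_isomorphic (functor_cat _ _) _ _ (eval_nat R k)).
  by apply: nat_trans_is_iso => V; exact: eval_hom_is_iso.
apply: (@is_iso_isomorphic_sym (functor_cat _ _) _ _ (ray_sections_nat R k)).
by apply: nat_trans_is_iso => S; exact: ray_sections_nat_is_iso.
Qed.
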